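(* Let $X,Y$ be Banach spaces and $A,B:X\to Y$ bounded linear operators. Then $\mathbf{NP}_\infty(A+B,X,Y)\leqslant\omega\bigl(\mathbf{NP}_\infty(A,X,Y)\vee\mathbf{NP}_\infty(B,X,Y)\bigr)$.
   Context: $\vee$ denotes maximum; products of ordinals are ordinal products. A tree $T$ on a set is a set of finite sequences (the empty sequence allowed) closed under initial segments. $T'$ is $T$ minus its maximal members; $T^0=T$, $T^{\xi+1}=(T^\xi)'$, $T^\xi=\bigcap_{\zeta<\xi}T^\zeta$ for limit $\xi$; $o(T)$ is the least ordinal $\xi$ with $T^\xi=\varnothing$, or $\infty$ if there is none; $\xi<\infty$ and $\xi\infty=\infty\xi=\infty$ for every ordinal $\xi$. For an operator $A:X\to Y$ and $K\geqslant1$, $T_\infty(A,X,Y,K)$ is the tree of finite sequences $(x_i)_{i=1}^n$ in the closed unit ball $B_X$ such that for all scalars $\|\sum_{i=1}^na_ix_i\|\leqslant\max_i|a_i|$ and $\max_i|a_i|\leqslant K\|\sum_{i=1}^na_iAx_i\|$; $\mathbf{NP}_\infty(A,X,Y)=\sup_{K\geqslant1}o(T_\infty(A,X,Y,K))$. *)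

(* Defs.v *)
From HB Require Import structures.
From mathcomp Require Import all_boot all_order all_algebra.
From mathcomp Require Import all_classical all_reals all_analysis.
From mathcomp Require Export complex.

Set Implicit Arguments.
Unset Strict Implicit.
Unset Printing Implicit Defensive.

Import Order.TTheory GRing.Theory Num.Theory.
Import numFieldNormedType.Exports.

Local Open Scope classical_set_scope.
Local Open Scope ring_scope.

(* Ordinals, as well-founded trees: [Ord f] is the least ordinal greater than
   every [f i], i.e. the von Neumann ordinal whose elements are the ordinals
   below or equal to some [f i].  Distinct terms may denote the same ordinal;
   equality of ordinals is [oeq], and is never Leibniz equality. *)
Inductive ord : Type := Ord (D : Type) (f : D -> ord).

Definition oidx (a : ord) : Type := match a with Ord D _ => D end.
Definition ofam (a : ord) : oidx a -> ord := match a with Ord D f => f end.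

Fixpoint ole (a b : ord) : Prop :=
  match a, b with
  | Ord D f, Ord E g => forall i : D, exists j : E, ole (f i) (g j)
  end.

Definition olt (a b : ord) : Prop := exists j : oidx b, ole a (ofam j).
Definition oeq (a b : ord) : Prop := ole a b /\ ole b a.

Definition ozero : ord := Ord (of_void ord).
Definition osucc (a : ord) : ord := Ord (fun _ : unit => a).
Definition ofin (n : nat) : ord := iter n osucc ozero.
Definition omega : ord := Ord ofin.
Definition olimit (a : ord) : Prop :=
  olt ozero a /\ forall b, olt b a -> olt (osucc b) a.

Definition osup (I : Type) (F : I -> ord) : ord :=
  Ord (fun p : {i : I & oidx (F i)} => ofam (tagged p)).

(* [a + b] is the least ordinal greater than every [a' < a] and every
   [a + b'], [b' < b]. *)
Fixpoint oadd (a b : ord) : ord :=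
  match b with
  | Ord E g => Ord (fun k : (oidx a + E)%type =>
      match k with inl i => ofam i | inr j => oadd a (g j) end)
  end.

(* [a * b] ([b] copies of [a] in a row) is the least ordinal greater than
   every [a * b' + a'], [b' < b], [a' < a]. *)
Fixpoint omul (a b : ord) : ord :=
  match b with
  | Ord E g => Ord (fun k : (E * oidx a)%type =>
      oadd (omul a (g k.1)) (ofam k.2))
  end.

Lemma ole_refl a : ole a a.
Proof. by elim: a => I f IH i; exists i; apply: IH. Qed.
#[global] Hint Resolve ole_refl : core.

Lemma ole_trans b a c : ole a b -> ole b c -> ole a c.
Proof.
elim: a b c => I f IH [J g] [K h] /= fg gh i.
have [j fij] := fg i; have [k gjk] := gh j.
by exists k; apply: IH fij gjk.
Qed.

Lemma oeq_sym a b : oeq a b -> oeq b a.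
Proof. by case. Qed.

Lemma oeq_trans b a c : oeq a b -> oeq b c -> oeq a c.
Proof.
move=> [ab ba] [bc cb].
by split; [apply: ole_trans bc | apply: ole_trans ba].
Qed.

Lemma oleP a b : ole a b <-> forall i : oidx a, olt (ofam i) b.
Proof. by case: a b => [I f] [J g]. Qed.
#[global] Arguments ole : simpl never.

Lemma olt_fam a (i : oidx a) : olt (ofam i) a.
Proof. by exists i. Qed.

Lemma ole_lt_trans b a c : ole a b -> olt b c -> olt a c.
Proof. by move=> ab [j bj]; exists j; apply: ole_trans bj. Qed.

Lemma olt_le_trans b a c : olt a b -> ole b c -> olt a c.
Proof. by move=> [j aj] bc; apply: ole_lt_trans aj ((oleP b c).1 bc j). Qed.

Lemma oltW a b : olt a b -> ole a b.
Proof.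
elim: a b => I f IH [J g] [j /= fj]; apply/oleP => i /=.
by exists j; apply: (IH i); apply: olt_le_trans fj; exists i.
Qed.

Lemma olt_irr a : ~ olt a a.
Proof.
by elim: a => I f IH [i /= fi]; apply: (IH i); apply: olt_le_trans fi; exists i.
Qed.

Lemma ole_or_lt a b : ole a b \/ olt b a.
Proof.
elim: a b => I f IH b; have [|/existsNP [i fb]] := pselect (forall i, olt (f i) b).
  by move=> fb; left; apply/oleP.
right; exists i; apply/oleP => j; case: (IH i (ofam j)) => // fij.
by case: fb; exists j.
Qed.

Lemma ole_total a b : ole a b \/ ole b a.
Proof. by have [|/oltW] := ole_or_lt a b; [left | right]. Qed.

Lemma olt_succ a b : olt a (osucc b) <-> ole a b.
Proof. by split=> [[]|ab] //; exists tt. Qed.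

Lemma ole_succ a b : ole (osucc a) b <-> olt a b.
Proof. by split=> [/oleP /(_ tt)|ab] //; apply/oleP. Qed.

Lemma ole0 a : ole ozero a.
Proof. by apply/oleP => -[]. Qed.

Lemma olimit_eq a b : oeq a b -> olimit a -> olimit b.
Proof.
move=> [ab ba] [a0 aS]; split=> [|c cb]; first exact: olt_le_trans ab.
by apply: olt_le_trans ab; apply: aS; apply: olt_le_trans ba.
Qed.

Lemma osup_lub (I : Type) (F : I -> ord) b :
  ole (osup F) b <-> forall i, ole (F i) b.
Proof.
split=> [/oleP Fb i|Fb]; apply/oleP.
  by move=> k; apply: (Fb (existT _ i k)).
by move=> [i k]; apply: (olt_le_trans _ (Fb i)); apply: olt_fam.
Qed.

(* The usual recursive clauses of ordinal addition and multiplication. *)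
Lemma ole_addP a b c :
  ole (oadd a b) c <-> ole a c /\ forall j : oidx b, olt (oadd a (ofam j)) c.
Proof.
case: b => J g; split=> [/oleP bc|[ac bc]].
  by split=> [|j]; [apply/oleP => i; apply: (bc (inl i)) | apply: (bc (inr j))].
by apply/oleP => -[i|j] //=; apply: (olt_le_trans _ ac); apply: olt_fam.
Qed.

Lemma ole_mulP a b c : ole (omul a b) c <->
  forall (j : oidx b) (i : oidx a), olt (oadd (omul a (ofam j)) (ofam i)) c.
Proof.
case: b => J g; split=> [/oleP bc j i|bc]; first exact: (bc (j, i)).
by apply/oleP => -[j i]; apply: bc.
Qed.

Lemma ole_add2l a b c : ole b c -> ole (oadd a b) (oadd a c).
Proof.
elim: b c => J g IH [K h] bc; apply/ole_addP; split.
  by have /ole_addP[] := ole_refl (oadd a (Ord h)).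
by move=> j; have [k gh] := bc j; exists (inr k); apply: IH.
Qed.

Lemma oadd0 a : oeq (oadd a ozero) a.
Proof.
by split; [apply/ole_addP; split=> // -[] | apply/oleP => i; exists (inl i)].
Qed.

Lemma oaddS a b : oeq (oadd a (osucc b)) (osucc (oadd a b)).
Proof.
split; last by apply/ole_succ; exists (inr tt) => /=.
apply/ole_addP; split=> [|[]]; last exact/olt_succ.
apply: oltW; apply/olt_succ.
by have /ole_addP[] := ole_refl (oadd a b).
Qed.

Lemma oadd_limit a b c : olimit b ->
  ole (oadd a b) c <-> forall b', olt b' b -> ole (oadd a b') c.
Proof.
move=> [b0 bS]; split=> [abc b' b'b|abc].
  by apply: ole_trans abc; apply: ole_add2l; apply: oltW.
apply/ole_addP; split=> [|j].
  by apply: ole_trans (abc _ b0); case: (oadd0 a).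
have /abc := bS _ (olt_fam j); apply: olt_le_trans.
by apply: (olt_le_trans _ (oaddS _ _).2); apply/olt_succ.
Qed.

Lemma ole_mul2l a b c : ole b c -> ole (omul a b) (omul a c).
Proof.
elim: b c => J g IH [K h] bc; apply/ole_mulP => j i /=.
have [k gh] := bc j; exists (k, i) => /=; move: (IH j _ gh).
move: (omul a (g j)) (omul a (h k)) (ofam i) => x y z xy.
elim: z => Z f IHz; apply/ole_addP; split=> [|l].
  by apply: ole_trans xy _; have /ole_addP[] := ole_refl (oadd y (Ord f)).
by exists (inr l); apply: IHz.
Qed.

Lemma omul0 a : oeq (omul a ozero) ozero.
Proof. by split; [apply/ole_mulP => -[] | apply: ole0]. Qed.

Lemma omulS a b : oeq (omul a (osucc b)) (oadd (omul a b) a).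
Proof.
split; first by apply/ole_mulP => -[] i; case: a i => I f i; exists (inr i) => /=.
apply/ole_addP; split; last by move=> i; exists (tt, i) => /=.
by apply: ole_mul2l; apply: oltW; apply/olt_succ.
Qed.

Lemma omul_limit a b c : olimit b ->
  ole (omul a b) c <-> forall b', olt b' b -> ole (omul a b') c.
Proof.
move=> [b0 bS]; split=> [abc b' b'b|abc].
  by apply: ole_trans abc; apply: ole_mul2l; apply: oltW.
apply/ole_mulP => j i; have /abc := bS _ (olt_fam j); apply: olt_le_trans.
by exists (tt, i) => /=.
Qed.

(* Ordinals extended with [Infty]. *)
Inductive eord : Type := Fin of ord | Infty.

Definition eole (x y : eord) : Prop :=
  match x, y with
  | Fin a, Fin b => ole a b
  | _, Infty => True
  | Infty, Fin _ => False
  end.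

Definition emul (x y : eord) : eord :=
  match x, y with
  | Fin a, Fin b => Fin (omul a b)
  | _, _ => Infty
  end.

Definition emax (x y : eord) : eord := if `[< eole x y >] then y else x.

Definition esup (I : Type) (F : I -> eord) : eord :=
  if `[< exists i, F i = Infty >] then Infty
  else Fin (osup (fun i => if F i is Fin a then a else ozero)).

Lemma eole_total x y : eole x y \/ eole y x.
Proof. by case: x y => [a|] [b|] /=; [apply: ole_total | left | right | left]. Qed.

Lemma esup_lub (I : Type) (F : I -> eord) y :
  eole (esup F) y <-> forall i, eole (F i) y.
Proof.
rewrite /esup; case: asboolP => [[k Fk]|noInf].
  split; first by case: y => // _ i; case: (F i).
  by move=> /(_ k); rewrite Fk.
case: y => [b|] /=; last by split=> // _ i; case: (F i).
rewrite osup_lub; split=> Fb i; move: (Fb i); case E: (F i) => [a|] //=.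
by move=> _; apply: noInf; exists i.
Qed.

Section Tree.
Variable X : eqType.
Implicit Types (S T : set (seq X)) (s t : seq X).

Definition maximal_members S : set (seq X) :=
  [set s | S s /\ forall t, S t -> prefix s t -> t = s].

Definition prune S : set (seq X) := S `\` maximal_members S.

(* The three cases are exclusive, and [derived0], [derivedS], [derived_limit]
   below are the defining clauses of the transfinite iteration of [prune]. *)
Fixpoint derived T (xi : ord) : set (seq X) :=
  match xi with
  | Ord D f => [set s |
      [\/ oeq xi ozero /\ T s,
          exists2 i : D, oeq xi (osucc (f i)) & prune (derived T (f i)) s
        | olimit xi /\ forall i : D, derived T (f i) s]]
  end.

Definition is_order T (xi : ord) : Prop :=
  derived T xi = set0 /\ forall zeta, derived T zeta = set0 -> ole xi zeta.

(* The order of [T]; [Fin xi] is determined up to [oeq]. *)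
Definition tree_order T : eord :=
  if pselect (exists xi, is_order T xi) is left ex then Fin (projT1 (cid ex))
  else Infty.

Lemma pruneP S s :
  prune S s <-> S s /\ exists t, [/\ S t, prefix s t & t <> s].
Proof.
split=> [[Ss nmax]|[Ss [t [St st ts]]]]; last first.
  by split=> // -[_ /(_ t St st)].
split=> //; apply: contrapT => /forallNP nex; apply: nmax; split=> // t St st.
by apply: contrapT => ts; apply: (nex t).
Qed.

Lemma prune_mono S S' : S `<=` S' -> prune S `<=` prune S'.
Proof.
move=> SS' s /pruneP [/SS' Ss [t [/SS' St st ts]]]; apply/pruneP.
by split=> //; exists t.
Qed.

Lemma derived_anti T a b : ole a b -> derived T b `<=` derived T a.
Proof.
elim: b a => J g IH [I f] ab s /= [[b0 Ts]|[j bS Ps]|[bL Ds]].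
- apply: Or31; split=> //; split; last exact: ole0.
  exact: ole_trans ab b0.1.
- case: (ole_or_lt (Ord f) (g j)) => [/IH|ga].
    by apply; case: Ps.
  have [i /= gf] := ga; apply: Or32; exists i.
    split; first exact: ole_trans ab (ole_trans bS.1 _).
    by apply/ole_succ; exists i => /=.
  apply: prune_mono Ps; apply: IH; apply/olt_succ.
  by apply: (olt_le_trans _ bS.1); apply: (olt_le_trans _ ab); exists i => /=.
- have [ba|[j aj]] := ole_or_lt (Ord g) (Ord f); last exact: (IH j _ aj).
  apply: Or33; split; first exact: olimit_eq bL.
  by move=> i; have [j fg] := ab i; apply: (IH j).
Qed.

Lemma derived0 T : derived T ozero = T.
Proof.
apply/seteqP; split=> s /=; first by case=> [[]//|[[]]|[[[]]]].
by move=> Ts; apply: Or31.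
Qed.

Lemma derivedS T a : derived T (osucc a) = prune (derived T a).
Proof.
apply/seteqP; split=> s /=; last by move=> Ps; apply: Or32; exists tt.
case=> [[[/oleP /(_ tt) []]//]|[]//|[[_ /(_ a)]]].
by move=> /(_ (olt_fam (tt : oidx (osucc a)))) /olt_succ /ole_succ /olt_irr.
Qed.

Lemma derived_limit T a :
  olimit a -> derived T a = [set s | forall b, olt b a -> derived T b s].
Proof.
move=> aL; apply/seteqP; split=> s.
  by move=> Ds b /oltW ba; apply: derived_anti Ds.
by case: a aL => I f aL Ds; apply: Or33; split=> // i; apply: Ds; exists i => /=.
Qed.

Lemma ord_least (P : ord -> Prop) :
  (exists a, P a) -> exists a, P a /\ forall b, P b -> ole a b.
Proof.
move=> [a]; have [k] : exists k, ole a k by exists a.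
elim: k a => I f IH a af Pa.
have [//|/forallNP nex] := pselect (exists b, P b /\ olt b a).
  move=> [b [Pb ba]]; have [i bi] := olt_le_trans ba af.
  exact: (IH i b).
exists a; split=> // b Pb; case: (ole_or_lt a b) => // ba.
by case: (nex b).
Qed.

Lemma tree_orderP T :
  match tree_order T with
  | Fin xi => is_order T xi
  | Infty => forall xi, derived T xi <> set0
  end.
Proof.
rewrite /tree_order; case: pselect => [ex|nex]; first by case: cid.
by move=> xi Txi; apply: nex; apply: ord_least; exists xi.
Qed.

(* [ord] has ordinals enough to exhaust every well-founded tree on [X]. *)
Lemma wf_derived_empty T :
  well_founded (fun t s => [/\ T t, prefix s t & t <> s]) ->
  exists xi, derived T xi = set0.
Proof.
move=> wfT; have sub xi : derived T xi `<=` T.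
  by rewrite -[X in _ `<=` X](derived0 T); apply: derived_anti; apply: ole0.
have {wfT} /choice [F FP] : forall s, exists xi, ~ derived T xi s.
  move=> s; elim: (wfT s) => {}s _ IH.
  have /choice [F FP] : forall t, exists xi,
      [/\ T t, prefix s t & t <> s] -> ~ derived T xi t.
    move=> t; have [/IH [xi]|nt] := pselect [/\ T t, prefix s t & t <> s].
      by exists xi.
    by exists ozero => /nt.
  exists (osucc (Ord F)); rewrite derivedS => /pruneP [_ [t [Dt st ts]]].
  apply: (FP t); first by split=> //; apply: sub Dt.
  by apply: derived_anti Dt; apply: oltW; exists t => /=.
exists (Ord F); apply/seteqP; split=> // s Ds.
by apply: (FP s); apply: derived_anti Ds; apply: oltW; exists s => /=.
Qed.

End Tree.

Section NP.
Variables (K : numFieldType) (X Y : normedModType K).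

Definition bounded_operator (A : X -> Y) : Prop :=
  exists M : K, forall x, `|A x| <= M * `|x|.

Lemma bounded_operatorP (A : {linear X -> Y}) :
  bounded_operator A <-> continuous A.
Proof.
rewrite -linear_bounded_continuous linear_boundedP; split=> [[M AM]|].
  near=> r => x; apply: (@le_trans _ _ (`|M| * `|x|)).
    have /ger0_norm : 0 <= M * `|x| by apply: le_trans (AM x).
    by rewrite normrM normr_id => ->.
  by rewrite ler_wpM2r//; near: r; apply: nbhs_pinfty_ge.
by move=> /pinfty_ex_gt0 [M _ AM]; exists M.
Unshelve. all: by end_near. Qed.

(* The maximum is over nonnegative reals, so [0] is a neutral initial value
   (and the value for the empty sequence). *)
Definition max_norm (n : nat) (a : 'I_n -> K) : K :=
  \big[Num.max/0]_(i < n) `|a i|.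

Definition T_infty (A : X -> Y) (C : K) : set (seq X) :=
  [set s : seq X | (forall x, x \in s -> `|x| <= 1) /\
     forall a : 'I_(size s) -> K,
       `|\sum_(i < size s) a i *: s`_i| <= max_norm a /\
       max_norm a <= C * `|\sum_(i < size s) a i *: A s`_i|].

Definition NP_infty (A : X -> Y) : eord :=
  esup (fun C : {C : K | 1 <= C} => tree_order (T_infty A (sval C))).

End NP.

(* Main.v *)
Require Import Defs.
From mathcomp Require Import all_boot all_order all_algebra.
From mathcomp Require Import all_classical all_reals all_analysis.
From mathcomp Require Import ring lra.
Import Order.TTheory GRing.Theory Num.Theory.
Import numFieldNormedType.Exports.
Local Open Scope classical_set_scope.
Local Open Scope ring_scope.
Set Implicit Arguments.
Unset Strict Implicit.
Unset Printing Implicit Defensive.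

(** Say that a node of a tree has rank at least [a] when it survives [a]
    derivations.  The trees [T_infty] are closed under prefixes, so their order
    is at most [a] exactly when the empty sequence has no rank [>= a].  The
    claim becomes: if the root of the tree of [A + B] with constant [C] has rank
    [>= omega * a], then for some constant the root of the tree of [A], or of
    [B], has rank [>= a].

    Choosing an operator.  On a member [x] of a sequence of [T_infty (A + B) C]
    one has [1/C <= |A x + B x|], so that [A] or [B] is at least
    [d = 1/(2C)] on [x].  A sequence splits into its [A]-part and its [B]-part,
    and both parts still satisfy the upper [c_0] estimate.  Let [S_A] and [S_B]
    be the trees of the sequences with that estimate on which [A], respectively
    [B], is at least [d]; say that the rank of [S_B] is at most that of [S_A].
    Then a move in the [B]-part can be answered by a move in a second copy of
    [S_A], and the rank [omega * a] passes to the tree of the shuffles of two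
    sequences of [S_A] ([rank_ge_merges]).  No natural sum of ordinals has to be
    estimated.  Shuffles satisfy the upper estimate with constant [2], and [A]
    is at least [d] on their members.

    Recovering the lower estimate.  This is where the factor [omega] is spent.
    Suppose that the images under [A] of the members kept so far satisfy a lower
    [c_0] estimate.  In a long enough sequence of vectors of norm at least [d]
    with an upper [c_0] estimate, some vector can be added at an arbitrarily
    small cost in the lower constant ([extend_lower_c0]).  Indeed, otherwise
    each of the vectors [y_j] has a normalized combination [f_j + b_j y_j] that
    is too short; by total boundedness of the coefficients many of the [f_j] are
    nearly equal to a single [f]; averaging over those [j] makes the
    contribution of the [y_j] negligible, because of their upper estimate, so
    that [f] is too short either for the estimate already obtained or for some
    [b_j y_j] of norm at least [d].  A node of rank [>= omega * (z + 1)] has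
    extensions of any prescribed length of rank [>= omega * z], and one member
    is kept from each of them; the total loss of the constant is kept below a
    factor [2] ([rank_ge_T_infty]).  Halving the members finally brings the
    upper constant from [2] down to [1].

    The scalars enter only through total boundedness of the unit ball and the
    archimedean property, so the argument is carried out over a numeric field
    with these two properties and is then applied to the reals and to the
    complex numbers. *)

(** * Ranks of nodes in trees of finite sequences *)

Section Rank.
Variable X : eqType.
Implicit Types (S T : set (seq X)) (s t : seq X) (a b : ord).

(** For a tree [T] closed under prefixes this is membership of [s] in the
    derivative of order [a], unfolded as a game: no distinction is made between
    successors and limits, and each move adds a single element. *)
Fixpoint rank_ge T a s : Prop :=
  match a with
  | Ord D f => T s /\ forall i : D, exists x, rank_ge T (f i) (rcons s x)
  end.

Lemma rank_ge_in T a s : rank_ge T a s -> T s.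
Proof. by case: a => D f []. Qed.

Lemma rank_ge_sub S T : S `<=` T -> forall a s, rank_ge S a s -> rank_ge T a s.
Proof.
move=> ST; elim=> D f IH s [/ST Ts ext]; split=> // i.
by have [x /IH] := ext i; exists x.
Qed.

Lemma rank_ge_anti T a b s : ole a b -> rank_ge T b s -> rank_ge T a s.
Proof.
elim: a b s => D f IH [E g] s ab [Ts ext]; split=> // i.
have [j fg] := ab i; have [x bx] := ext j.
by exists x; apply: IH fg bx.
Qed.

Lemma rank_ge_osup T (I : Type) (F : I -> ord) s :
  T s -> (forall i, rank_ge T (F i) s) -> rank_ge T (osup F) s.
Proof.
move=> Ts TF; split=> // -[i k] /=.
by case: (F i) (TF i) k => D f [_ ext] k; apply: ext.
Qed.

(** Comparability of ranks.  The ranks themselves are not named, as an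
    ill-founded tree has none in [ord]. *)
Lemma rank_ge_total S T s t :
  (forall a, rank_ge S a s -> rank_ge T a t) \/
  (forall a, rank_ge T a t -> rank_ge S a s).
Proof.
have [|/existsNP [a /not_implyP [Sa nTa]]] :=
  pselect (forall a, rank_ge S a s -> rank_ge T a t); first by left.
right=> b Tb; have [ba|ab] := ole_total b a; first exact: rank_ge_anti ba Sa.
by case: nTa; apply: rank_ge_anti ab Tb.
Qed.

(** The [n] topmost successors of [a + n] pay for [n] moves. *)
Lemma rank_ge_oadd_ofin T a n s :
  rank_ge T (oadd a (ofin n)) s ->
  exists2 t, size t = n & rank_ge T a (s ++ t).
Proof.
elim: n s => [|n IH] s.
  move=> /(rank_ge_anti (oadd0 a).2) Ta.
  by exists [::] => //; rewrite cats0.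
move=> [_ /(_ (inr tt)) [x /IH [t tn Tt]]].
by exists (x :: t); rewrite /= ?tn // -cat_rcons.
Qed.

Definition prefix_closed T := forall s t, prefix s t -> T t -> T s.

Lemma derived_sub T a : derived T a `<=` T.
Proof.
by rewrite -[X in _ `<=` X]derived0; apply: derived_anti; apply: ole0.
Qed.

Lemma derived_prefix_closed T a :
  prefix_closed T -> prefix_closed (derived T a).
Proof.
move=> pcT; elim: a => D f IH s t st [[a0 Tt]|[i aS /pruneP Pt]|[aL Dt]].
- by apply: Or31; split=> //; apply: pcT Tt.
- apply: Or32; exists i => //; case: Pt => Dt [u [Du tu ut]].
  apply/pruneP; split; first exact: IH Dt.
  exists u; split=> //; first exact: prefix_trans tu.
  move=> us; apply: ut; rewrite us in tu *.
  case/prefixP: st tu => r ->.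
  case: r => [|x r /size_prefix]; first by rewrite cats0.
  by rewrite size_cat /= addnS ltnNge leq_addr.
- by apply: Or33; split=> // i; apply: IH (Dt i).
Qed.

(** Covers the three clauses of [derived] at once: an ordinal that is neither
    zero nor a limit is the successor of some [b] below it. *)
Lemma derived_all_below T a s :
  T s -> (forall b, olt b a -> prune (derived T b) s) -> derived T a s.
Proof.
move=> Ts Pb; have [a0|a0] := ole_or_lt a ozero.
  by apply: derived_anti a0 _ _; rewrite derived0.
have [aS|/existsNP [b /not_implyP [ba nb]]] :=
  pselect (forall b, olt b a -> olt (osucc b) a).
  by rewrite derived_limit //; move=> b /Pb /pruneP [].
apply: (@derived_anti _ _ _ (osucc b)); last by rewrite derivedS; apply: Pb.
by have [//|/nb] := ole_or_lt a (osucc b).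
Qed.

(** A proper extension in a tree closed under prefixes yields one by a single
    element, which is all that separates pruning from the moves of
    [rank_ge]. *)
Lemma derived_rank_ge T a s :
  prefix_closed T -> derived T a s <-> rank_ge T a s.
Proof.
move=> pcT; elim: a s => D f IH s; split.
  move=> Ds; split; first exact: derived_sub Ds.
  move=> i; have : derived T (osucc (f i)) s.
    by apply: derived_anti Ds; apply/ole_succ; exists i.
  rewrite derivedS => /pruneP [_ [t [Dt /prefixP [r tE] ts]]].
  case: r => [|x r] in tE; first by case: ts; rewrite tE cats0.
  exists x; apply/IH; apply: derived_prefix_closed Dt => //.
  by rewrite tE -cat_rcons prefix_prefix.
move=> [Ts ext]; apply: derived_all_below => // b [i /= bi].
have [x /IH Dx] := ext i.
apply: (@prune_mono _ (derived T (f i))); first exact: derived_anti.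
apply/pruneP; split.
  by apply: derived_prefix_closed Dx => //; rewrite -cats1 prefix_prefix.
exists (rcons s x); split=> //; first by rewrite -cats1 prefix_prefix.
by move=> /(congr1 size) /eqP; rewrite size_rcons eqn_leq ltnn.
Qed.

Definition merges S : set (seq X) :=
  [set w | exists p q, [/\ S p, S q & perm_eq w (p ++ q)]].

(** A play in [T] is simulated by a shuffle of its [c1]-part, which lies in
    [S1], with an answer [u] in [S1] to its [c2]-part.  The invariant is that
    the node [u] has in [S1] at least the rank that the [c2]-part has in
    [S2]. *)
Lemma rank_ge_merges (T S1 S2 : set (seq X)) (c1 c2 : pred X) :
  (forall x, c2 x = ~~ c1 x) ->
  (forall s, T s -> S1 [seq x <- s | c1 x] /\ S2 [seq x <- s | c2 x]) ->
  (forall a, rank_ge S2 a [::] -> rank_ge S1 a [::]) ->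
  forall a, rank_ge T a [::] -> rank_ge (merges S1) a [::].
Proof.
move=> c12 TS S21 a Ta.
suff H s u w : rank_ge T a s ->
    (forall b, rank_ge S2 b [seq x <- s | c2 x] -> rank_ge S1 b u) ->
    perm_eq w ([seq x <- s | c1 x] ++ u) -> rank_ge (merges S1) a w.
  exact: (H [::] [::]).
elim: a s u w {Ta S21} => D f IH s u w [Ts ext] su wE; split.
  exists [seq x <- s | c1 x], u; split=> //; first exact: (TS s Ts).1.
  by apply/(rank_ge_in (su ozero _)); split=> [|[]]; exact: (TS s Ts).2.
move=> i; have [x Tx] := ext i; have [_ S2x] := TS _ (rank_ge_in Tx).
case c1x : (c1 x).
  exists x; apply: (IH i _ u _ Tx); rewrite !filter_rcons ?c12 c1x //=.
  rewrite perm_rcons cat_rcons perm_sym -[x :: u]cat1s perm_catCA.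
  by rewrite perm_cons perm_sym.
move: S2x (IH i (rcons s x)); rewrite !filter_rcons c12 c1x /= => S2x IHi.
suff [y uy] : exists y, forall b,
    rank_ge S2 b (rcons [seq x <- s | c2 x] x) -> rank_ge S1 b (rcons u y).
  exists y; apply: (IHi _ _ Tx uy).
  by rewrite -!cats1 catA perm_cat2r.
(* If every answer [y] failed at some ordinal [F y], then at the successor of
   their supremum [u] would have a move [z], and [z] does not fail at [F z]. *)
apply: contrapT => /forallNP nex.
have /choice [F FP] : forall y, exists b,
    rank_ge S2 b (rcons [seq x <- s | c2 x] x) /\ ~ rank_ge S1 b (rcons u y).
  by move=> y; have /existsNP [b /not_implyP] := nex y; exists b.
have /su [_ /(_ tt) [z uz]] : rank_ge S2 (osucc (osup F)) [seq x <- s | c2 x].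
  split=> [|_]; first exact: (TS s Ts).2.
  by exists x; apply: rank_ge_osup => // y; case: (FP y).
case: (FP z) => _; apply; apply: (@rank_ge_anti _ _ (osup F)) uz.
exact: ((osup_lub F _).1 (ole_refl _) z).
Qed.

End Rank.

(** * Linear combinations and [c_0] estimates *)

Section Lincomb.
Variables (K : numFieldType) (V : lmodType K).
Implicit Types (a b : nat -> K) (s t : seq V).

Definition lincomb a s : V := \sum_(i < size s) a i *: s`_i.

Lemma eq_lincomb a b s :
  (forall i, (i < size s)%N -> a i = b i) -> lincomb a s = lincomb b s.
Proof. by move=> ab; apply: eq_bigr => i _; rewrite ab. Qed.

Lemma lincomb_cat a s t :
  lincomb a (s ++ t) = lincomb a s + lincomb (fun i => a (size s + i)%N) t.
Proof.
rewrite /lincomb size_cat big_split_ord /=; congr (_ + _).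
  by apply: eq_bigr => i _; rewrite nth_cat ltn_ord.
by apply: eq_bigr => i _; rewrite nth_cat ltnNge leq_addr /= addKn.
Qed.

Lemma lincomb_catl a s t :
  lincomb a s = lincomb (fun i => if (i < size s)%N then a i else 0) (s ++ t).
Proof.
rewrite lincomb_cat -[LHS]addr0; congr (_ + _).
  by apply: eq_lincomb => i ->.
by rewrite /lincomb big1 // => i _; rewrite ltnNge leq_addr scale0r.
Qed.

Lemma lincomb_rcons a s x :
  lincomb a (rcons s x) = lincomb a s + a (size s) *: x.
Proof. by rewrite -cats1 lincomb_cat {2}/lincomb big_ord1 /= addn0. Qed.

Lemma lincombB a b s :
  lincomb (fun i => a i - b i) s = lincomb a s - lincomb b s.
Proof. by rewrite -sumrB; apply: eq_bigr => i _; rewrite scalerBl. Qed.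

Lemma lincombZ (k : K) a s : lincomb (fun i => k * a i) s = k *: lincomb a s.
Proof. by rewrite scaler_sumr; apply: eq_bigr => i _; rewrite scalerA. Qed.

Lemma lincomb_scale (k : K) a s :
  lincomb a (map ( *:%R k) s) = k *: lincomb a s.
Proof.
rewrite /lincomb size_map scaler_sumr; apply: eq_bigr => i _.
by rewrite (nth_map 0) // !scalerA mulrC.
Qed.

Lemma lincomb_delta k s : lincomb (fun i => (i == k)%:R) s = s`_k.
Proof.
rewrite /lincomb; have [ks|sk] := ltnP k (size s); last first.
  rewrite nth_default // big1 // => i _.
  by rewrite (ltn_eqF (leq_trans (ltn_ord i) sk)) scale0r.
rewrite (bigD1 (Ordinal ks)) //= eqxx scale1r big1 ?addr0 // => i ik.
by rewrite (_ : _ == k = false) ?scale0r //; apply/negbTE.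
Qed.

Lemma perm_lincomb a s t :
  perm_eq s t -> exists f : nat -> nat, lincomb a s = lincomb (a \o f) t.
Proof.
case/(perm_iotaP 0) => Is pIs ->.
exists (index^~ Is).
rewrite /lincomb size_map.
have uIs : uniq Is by rewrite (perm_uniq pIs) iota_uniq.
transitivity (\sum_(j <- Is) (a (index j Is)) *: t`_j).
  rewrite (big_nth 0%N) big_mkord; apply: eq_bigr => i _.
  by rewrite index_uniq // (nth_map 0%N).
by rewrite (perm_big _ pIs) -[in iota _ _](subn0 (size t)) big_mkord.
Qed.

End Lincomb.

Lemma linear_lincomb (K : numFieldType) (V W : lmodType K)
    (A : {linear V -> W}) a s :
  lincomb a (map A s) = A (lincomb a s).
Proof.
rewrite /lincomb linear_sum size_map; apply: eq_bigr => i _.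
by rewrite linearZ (nth_map 0).
Qed.

Section Estimates.
Variables (K : numFieldType) (V : normedModType K).
Implicit Types (a b : nat -> K) (s t : seq V) (D u r : K).

(** Coefficients are indexed by all of [nat], which avoids casts between ordinal
    types when sequences are extended, split or permuted. *)
Definition upper_c0 D s :=
  forall a r, (forall i, `|a i| <= r) -> `|lincomb a s| <= D * r.

Definition lower_c0 u s :=
  forall a i, (i < size s)%N -> u * `|a i| <= `|lincomb a s|.

Lemma upper_c0_perm D s t : perm_eq s t -> upper_c0 D t -> upper_c0 D s.
Proof.
move=> st tD a r ar; have [f ->] := perm_lincomb a st.
by apply: tD => i; apply: ar.
Qed.

Lemma upper_c0_cat D E s t :
  upper_c0 D s -> upper_c0 E t -> upper_c0 (D + E) (s ++ t).
Proof.
move=> sD tE a r ar; rewrite lincomb_cat mulrDl.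
by apply: (le_trans (ler_normD _ _)); apply: lerD; [apply: sD | apply: tE].
Qed.

Lemma upper_c0_catl D s t : upper_c0 D (s ++ t) -> upper_c0 D s.
Proof.
move=> stD a r ar; rewrite (lincomb_catl _ _ t); apply: stD => i.
by case: ifP => // _; rewrite normr0; apply: le_trans (ar 0%N).
Qed.

Lemma lower_c0_catl u s t : lower_c0 u (s ++ t) -> lower_c0 u s.
Proof.
move=> stu a i si; rewrite (lincomb_catl _ _ t).
have := stu (fun j => if (j < size s)%N then a j else 0) i.
by rewrite size_cat ltn_addr // si; apply.
Qed.

Lemma upper_c0_subseq D s t : subseq s t -> upper_c0 D t -> upper_c0 D s.
Proof.
move=> /perm_to_subseq [r tsr] tD; apply: (@upper_c0_catl _ _ r).
by apply: upper_c0_perm tD; rewrite perm_sym.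
Qed.

Lemma norm_argmax a n :
  exists2 k, (k <= n)%N & forall i, (i <= n)%N -> `|a i| <= `|a k|.
Proof.
elim: n => [|n [k kn ak]].
  by exists 0%N => // i; rewrite leqn0 => /eqP ->.
have [le|/ltW le] := real_leP (normr_real (a n.+1)) (normr_real (a k)).
  exists k => [|i]; first exact: leqW.
  by rewrite leq_eqVlt => /orP[/eqP ->|/ak].
exists n.+1 => // i; rewrite leq_eqVlt => /orP[/eqP -> //|/ak].
by move=> /le_trans; apply.
Qed.

(** A combination that violates the estimate can be divided by its largest
    coefficient. *)
Lemma not_lower_c0_normalized u s : 0 <= u -> ~ lower_c0 u s -> exists a i,
  [/\ (i < size s)%N, forall j, `|a j| <= 1, `|a i| = 1 & `|lincomb a s| < u].
Proof.
move=> u0 /existsNP [a /existsNP [i /not_implyP [lti /negP]]].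
have ur (x : V) (z : K) : (u * `|z| <= `|x|) = ~~ (`|x| < u * `|z|).
  by rewrite real_leNgt ?realM ?normr_real ?ger0_real.
rewrite ur negbK => lt_a.
have [k ks ak] := norm_argmax a (size s).-1.
have si j : (j < size s)%N = (j <= (size s).-1)%N.
  by case: (size s) lti.
have {lt_a} lt_a : `|lincomb a s| < u * `|a k|.
  by apply: lt_le_trans lt_a _; rewrite ler_wpM2l // ak // -si.
have ak0 : 0 < `|a k|.
  rewrite lt_neqAle normr_ge0 andbT; apply: contraTneq lt_a => <-.
  by rewrite mulr0 -real_leNgt ?normr_real.
exists (fun j => (`|a k|)^-1 * (if (j < size s)%N then a j else 0)), k.
rewrite si ks; split=> // [j||].
- rewrite normrM normfV normr_id ler_pdivrMl // mulr1.
  by case: ifP => [|_]; rewrite ?normr0 // si => /ak.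
- by rewrite normrM normfV normr_id mulVf // gt_eqF.
rewrite lincombZ normrZ normfV normr_id ltr_pdivrMl // mulrC.
by rewrite (@eq_lincomb _ _ _ a) // => j ->.
Qed.

End Estimates.

(** Total boundedness of the unit ball: finitely many classes of diameter at
    most [e] cover it. *)
Definition precompact_ball (K : numFieldType) := forall e : K, 0 < e ->
  exists (F : finType) (rho : K -> F), forall x y,
    `|x| <= 1 -> `|y| <= 1 -> rho x = rho y -> `|x - y| <= e.

Lemma large_fiber (F : finType) (n m : nat) (f : 'I_n -> F) :
  (#|F| * m < n)%N -> exists c, (m < #|[pred j | f j == c]|)%N.
Proof.
move=> Fmn; apply/existsP; apply: contraLR Fmn => /existsPn small.
rewrite -leqNgt -[X in (X <= _)%N](card_ord n) -sum1_card.
rewrite (partition_big f xpredT) //= -sum_nat_const; apply: leq_sum => c _.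
by rewrite (sum1_card [pred j | f j == c]) leqNgt small.
Qed.

Section Extend.
Variables (K : numFieldType) (V : normedModType K).
Hypothesis pK : precompact_ball K.
Hypothesis aK : Num.archimedean_axiom K.
Implicit Types (a b : nat -> K) (s t : seq V) (D u r : K).

(** If no vector of [t] were admissible, each [t_j] would have a normalized
    combination [f_j + b_j t_j] of norm less than [u'].  Many of the [f_j] have
    coefficients close to those of a single [f], and averaging over these [j]
    bounds the norm of [f] by [u'] plus an error less than [u - u'], because the
    upper estimate bounds the sum of the [b_j t_j] whatever their number.  A
    coefficient of modulus [1] in [f] then contradicts the lower estimate of
    [s]; a coefficient [b_j] of modulus [1] contradicts [d <= |t_j|]. *)
Lemma extend_lower_c0 D d u u' s :
  0 <= D -> 0 <= u' -> u' < u -> u + u' <= d -> upper_c0 D s -> lower_c0 u s ->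
  exists N, forall t, size t = N -> upper_c0 D t ->
    (forall x, x \in t -> d <= `|x|) ->
  exists2 x, x \in t & lower_c0 u' (rcons s x).
Proof.
move=> D0 u'0 u'u uud sD us.
(* Half of the error [e] allows for replacing [f_j] by [f], half for the
   averaged [b_j t_j]. *)
pose e := (u - u') / 2.
have e0 : 0 < e by rewrite divr_gt0 ?subr_gt0.
have e20 : 0 < e / 2 by apply: divr_gt0.
pose eta := e / 2 / (D + 1).
have D1 : 0 < D + 1 by rewrite ltr_wpDl.
have [F [rho rhoP]] : exists (F : finType) (rho : K -> F), forall x y,
    `|x| <= 1 -> `|y| <= 1 -> rho x = rho y -> `|x - y| <= eta.
  by apply: pK; apply: divr_gt0 => //; apply: divr_gt0.
have Deta : D * eta <= e / 2.
  rewrite mulrA ler_pdivrMr // mulrC; apply: ler_wpM2l; last by rewrite lerDl.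
  by apply: ltW; apply: divr_gt0.
have [m Dm] : exists m : nat, D <= e / 2 * m%:R.
  have [m] := aK (D / (e / 2)).
  rewrite ger0_norm; last exact: divr_ge0 D0 (ltW e20).
  by rewrite ltr_pdivrMr // mulrC => /ltW; exists m.
set k := size s.
exists (#|{ffun 'I_k -> F}| * m).+1 => t tN tD td.
apply: contrapT => nex.
have /choice [a /choice [i aP]] : forall j : 'I_(size t), exists a i,
    [/\ (i < k.+1)%N, forall j, `|a j| <= 1, `|a i| = 1 &
        `|lincomb a s + a k *: t`_j| < u'].
  move=> j; have [|a [i aiP]] :=
    @not_lower_c0_normalized _ _ u' (rcons s t`_j) u'0 _.
    by move=> l; apply: nex; exists t`_j; rewrite ?mem_nth.
  by move: aiP; rewrite size_rcons lincomb_rcons; exists a, i.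
(* The vectors are classified by the [k] approximate coefficients on [s]. *)
pose col (j : 'I_(size t)) : {ffun 'I_k -> F} := [ffun l : 'I_k => rho (a j l)].
have [c] : exists c, (m < #|[pred j | col j == c]|)%N.
  by apply: large_fiber; rewrite tN.
set J := [pred j | col j == c] => mJ.
have m0J : (0 < #|J|)%N by apply: leq_trans mJ.
have /card_gt0P [j0 j0J] := m0J.
set f := lincomb (a j0) s.
have close j : j \in J -> `|f + a j k *: t`_j| <= u' + e / 2.
  move=> jJ; have -> : f + a j k *: t`_j =
      lincomb (a j) s + a j k *: t`_j +
      lincomb (fun l => if (l < k)%N then a j0 l - a j l else 0) s.
    rewrite addrAC; congr (_ + _).
    rewrite -[LHS](addrNK (lincomb (a j) s)) addrC -lincombB; congr (_ + _).
    by apply: eq_lincomb => l ->.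
  apply: (le_trans (ler_normD _ _)); apply: lerD.
    by have [_ _ _ /ltW] := aP j.
  apply: le_trans Deta; apply: sD => l; case: ifP => [lk|_]; last first.
    by rewrite normr0; apply: ltW; apply: divr_gt0.
  have [[_ b1 _ _] [_ b2 _ _]] := (aP j0, aP j).
  apply: rhoP => //; move: j0J jJ; rewrite !inE => /eqP <- /eqP /ffunP.
  by move=> /(_ (Ordinal lk)); rewrite !ffunE.
have uE : u' + e + e = u.
  by rewrite -addrA -splitr addrC subrK.
have fu : `|f| <= u' + e.
  have cJ : 0 < #|J|%:R :> K by rewrite ltr0n.
  rewrite -(ler_pM2l cJ).
  have -> : #|J|%:R * `|f| = `|\sum_(j in J) (f + a j k *: t`_j) -
      lincomb (fun l =>
        if insub l is Some j then if j \in J then a j k else 0 else 0) t|.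
    rewrite big_split /= sumr_const [X in _ + X - _]big_mkcond /=.
    rewrite /lincomb [X in _ - X](eq_bigr (fun j : 'I_(size t) =>
      if j \in J then a j k *: t`_j else 0)).
      by rewrite addrK normrMn mulr_natl.
    by move=> j _; rewrite valK; case: ifP; rewrite ?scale0r.
  apply: (le_trans (ler_normB _ _)); rewrite [in leRHS](splitr e).
  rewrite addrA mulrDr; apply: lerD.
    apply: (le_trans (ler_norm_sum _ _ _)).
    by rewrite mulr_natl -sumr_const; apply: ler_sum.
  apply: (@le_trans _ _ (D * 1)).
    apply: tD => l; case: insubP => [j _ _|_]; last by rewrite normr0.
    by case: ifP; rewrite ?normr0 //; have [_ ? _ _] := aP j.
  rewrite mulr1 mulrC; apply: (le_trans Dm).
  by apply: ler_wpM2l; [apply: ltW | rewrite ler_nat ltnW].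
have [] := aP j0; rewrite ltnS leq_eqVlt.
move=> /orP[/eqP ik|ik] a1 ai lt_u; last first.
  have := us (a j0) _ ik; rewrite ai mulr1 => /le_trans /(_ fu).
  by rewrite -{1}uE gerDl => /le_lt_trans /(_ e0); rewrite ltxx.
have : d <= `|f + a j0 k *: t`_j0 - f|.
  by rewrite addrAC subrr add0r normrZ -ik ai mul1r td // mem_nth.
move=> /le_trans /(_ (ler_normB _ _)) /le_lt_trans /(_ (ltr_leD lt_u fu)).
have le_d : u' + (u' + e) <= d.
  by apply: le_trans uud; rewrite -uE addrC lerD2r lerDl ltW.
by move=> /lt_le_trans /(_ le_d); rewrite ltxx.
Qed.

End Extend.

(** * The trees [T_infty] *)

Lemma max_norm_le (K : numFieldType) n (a : 'I_n -> K) r :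
  max_norm a <= r <-> 0 <= r /\ forall i, `|a i| <= r.
Proof.
suff [_ H] : max_norm a \is Num.real /\
    (max_norm a <= r <->
     0 <= r /\ forall i, i \in index_enum 'I_n -> `|a i| <= r).
  rewrite H; split=> -[r0 ar]; split=> // i; apply: ar.
  by rewrite mem_index_enum.
rewrite /max_norm; elim: (index_enum _) => [|j s [IHr IH]].
  by rewrite big_nil; split=> //; split=> [r0|[]].
have cmp : `|a j| >=< \big[Num.max/0]_(i <- s) `|a i|.
  by rewrite real_comparable ?normr_real.
rewrite big_cons; split; first by apply: max_real; rewrite ?normr_real.
rewrite comparable_ge_max //; split.
  move=> /andP[aj /IH [r0 as_]]; split=> // i; rewrite inE => /orP[/eqP->//|].
  exact: as_.
move=> [r0 aS]; rewrite aS ?mem_head //=; apply/IH; split=> // i si.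
by rewrite aS // inE si orbT.
Qed.

Section TInfty.
Variables (K : numFieldType) (X Y : normedModType K).
Implicit Types (s t : seq X) (C : K).

(** The sequences that are to be thinned out to members of [T_infty]: the lower
    [c_0] estimate of the images is replaced with a lower bound on the norm of
    each of them. *)
Definition seminormalized (A : X -> Y) (M d : K) : set (seq X) :=
  [set s : seq X | [/\ forall x, x \in s -> `|x| <= 1, upper_c0 M s &
               forall x, x \in s -> d <= `|A x|]].

Lemma T_inftyP (A : X -> Y) C s : 0 < C ->
  T_infty A C s <->
  [/\ forall x, x \in s -> `|x| <= 1, upper_c0 1 s & lower_c0 C^-1 (map A s)].
Proof.
move=> C0; have sumA (a : nat -> K) :
    \sum_(i < size s) a i *: A s`_i = lincomb a (map A s).
  by rewrite /lincomb size_map; apply: eq_bigr => i _; rewrite (nth_map 0).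
split=> [[s1 sT]|[s1 us ls]].
  split=> // [a r ar|a i].
    rewrite mul1r; have [le_m _] := sT (fun i => a i).
    apply: le_trans le_m _; apply/max_norm_le; split=> //.
    exact: le_trans (ar 0%N).
  rewrite size_map => si; have [_] := sT (fun i => a i).
  by move=> /max_norm_le [_ /(_ (Ordinal si))]; rewrite sumA -ler_pdivrMl.
split=> // a.
pose b i := if insub i is Some j then a j else 0.
have bE (j : 'I_(size s)) : a j = b j by rewrite /b valK.
have b_le i : `|b i| <= max_norm a.
  have [m0 m_le] := (max_norm_le a _).1 (lexx _).
  by rewrite /b; case: insubP => [j _ _|_]; rewrite ?normr0.
rewrite (eq_bigr (fun i : 'I_(size s) => b i *: s`_i)); last first.
  by move=> i _; rewrite bE.
rewrite (eq_bigr (fun i : 'I_(size s) => b i *: A s`_i)); last first.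
  by move=> i _; rewrite bE.
split; first by have := us b _ b_le; rewrite mul1r.
rewrite sumA; apply/max_norm_le; split=> [|i]; first by rewrite mulr_ge0 // ltW.
have := ls b i; rewrite size_map ltn_ord => /(_ isT).
by rewrite -bE -ler_pdivrMl ?invr_gt0 // invrK.
Qed.

Lemma T_infty_seminormalized (A : X -> Y) C : 0 < C ->
  T_infty A C `<=` seminormalized A 1 C^-1.
Proof.
move=> C0 s /(T_inftyP _ _ C0) [s1 us ls]; split=> // x /(nthP 0) [k ks <-].
have := ls (fun i => (i == k)%:R) k.
by rewrite size_map ks lincomb_delta (nth_map 0) // eqxx normr1 mulr1 => ->.
Qed.

Lemma T_infty_prefix_closed (A : X -> Y) C :
  0 < C -> prefix_closed (T_infty A C).
Proof.
move=> C0 s _ /prefixP [t ->] /(T_inftyP _ _ C0) [s1 us ls].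
apply/(T_inftyP _ _ C0).
split; first by move=> x xs; apply: s1; rewrite mem_cat xs.
  exact: upper_c0_catl us.
by move: ls; rewrite map_cat => /lower_c0_catl.
Qed.

Lemma seminormalized_subseq (A : X -> Y) M d s t :
  subseq s t -> seminormalized A M d t -> seminormalized A M d s.
Proof.
move=> st [t1 tM td]; split; first by move=> x /(mem_subseq st) /t1.
  exact: upper_c0_subseq st tM.
by move=> x /(mem_subseq st) /td.
Qed.

Hypothesis pK : precompact_ball K.
Hypothesis aK : Num.archimedean_axiom K.

(** From the current node [w] a subsequence [y] is kept, whose images satisfy a
    lower estimate with a constant [u] in the interval from [d / 4] (excluded)
    to [d / 2].  Each step moves [u] to the middle of [d / 4] and [u], so it can
    be repeated along any branch. *)
Lemma rank_ge_T_infty (A : {linear X -> Y}) d a w y :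
  bounded_operator A -> 0 < d ->
  rank_ge (seminormalized A 2 d) (omul omega a) w -> subseq y w ->
  (exists u, [/\ d / 4 < u, u <= d / 2 & lower_c0 u (map A y)]) ->
  rank_ge (T_infty A (8 / d)) a (map ( *:%R 2^-1) y).
Proof.
move=> [M0 AM0] d0.
have [M M_ge0 AM] : exists2 M : K, 0 <= M & forall x, `|A x| <= M * `|x|.
  exists `|M0| => // x; have := ger0_norm (le_trans (normr_ge0 _) (AM0 x)).
  by rewrite normrM normr_id => ->.
have upperA s : upper_c0 2 s -> upper_c0 (M * 2) (map A s).
  move=> us b r br; rewrite linear_lincomb -mulrA.
  by apply: (le_trans (AM _)); rewrite ler_wpM2l // us.
elim: a w y => D f IH w y wR yw [u [du ud ly]]; split.
  have [w1 uw wd] := seminormalized_subseq yw (rank_ge_in wR).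
  have d8 : 0 < 8 / d by rewrite divr_gt0.
  apply/(T_inftyP _ _ d8); split.
  - move=> _ /mapP [x xy ->]; rewrite normrZ gtr0_norm ?invr_gt0 //.
    by rewrite ler_pdivrMl // mulr1 (le_trans (w1 x xy)) // ler1n.
  - move=> b r br; rewrite lincomb_scale normrZ gtr0_norm ?invr_gt0 // mul1r.
    by rewrite ler_pdivrMl //; apply: uw.
  move=> b i; rewrite !size_map => iy; rewrite invf_div.
  rewrite linear_lincomb lincomb_scale linearZ -linear_lincomb normrZ.
  rewrite gtr0_norm ?invr_gt0 // -ler_pdivrMl ?invr_gt0 // invrK mulrA.
  have := ly b i; rewrite size_map => /(_ iy); apply: le_trans.
  rewrite ler_wpM2r //; apply: le_trans (ltW du).
  rewrite mulrCA ler_wpM2l ?(ltW d0) //.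
  by rewrite (_ : 2 / 8 = 4^-1) //; field.
move=> i; case: wR => w_in ext.
have le_y := upperA _ (upper_c0_subseq yw (let: And3 _ h _ := w_in in h)).
pose u' := (d / 4 + u) / 2.
have [du' u'u] : d / 4 < u' /\ u' < u by have [] := midf_lt du.
have uud : u + u' <= d by rewrite [leRHS]splitr lerD // (le_trans (ltW u'u)).
have u'0 : 0 <= u' by apply: le_trans (ltW du'); rewrite divr_ge0 // ltW.
have [|N NP] := extend_lower_c0 pK aK _ u'0 u'u uud le_y ly.
  by rewrite mulr_ge0.
(* The index [(i, N)] of [omega * a] is the ordinal [omega * f i + N], so [N]
   can be chosen after [y]. *)
have [x0 /rank_ge_oadd_ofin [t tN tR]] := ext (i, N).
have [t1 ut td] := rank_ge_in tR.
have tw : subseq t (rcons w x0 ++ t) by apply: suffix_subseq.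
have [|||z] := NP (map A t).
- by rewrite size_map.
- by apply: upperA; apply: upper_c0_subseq tw ut.
- by move=> _ /mapP [x xt ->]; apply: td; apply: mem_subseq xt.
move=> /mapP [x xt ->]; rewrite -map_rcons => lyx.
exists (2^-1 *: x); rewrite -map_rcons.
apply: IH tR _ _; last by exists u'; split=> //; apply: le_trans ud; apply: ltW.
rewrite cat_rcons -cats1; apply: cat_subseq => //.
by rewrite sub1seq inE xt orbT.
Qed.

End TInfty.

(** * The order of the tree of a sum *)

Section Main.
Variables (K : numFieldType) (X Y : normedModType K).

Lemma merges_seminormalized (A : X -> Y) M d :
  merges (seminormalized A M d) `<=` seminormalized A (M + M) d.
Proof.
move=> w [p [q [[p1 pM pd] [q1 qM qd] wE]]].
have wpq x : x \in w -> x \in p \/ x \in q.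
  by rewrite (perm_mem wE) mem_cat => /orP.
split; first by move=> x /wpq [/p1|/q1].
  exact: upper_c0_perm wE (upper_c0_cat pM qM).
by move=> x /wpq [/pd|/qd].
Qed.

(** One of [A] and [B] keeps the whole rank: the one whose tree has the larger
    rank hosts both parts of each sequence. *)
Lemma seminormalized_add_rank (A B : X -> Y) M d a :
  0 <= d ->
  rank_ge (seminormalized (A \+ B) M (d + d)) a [::] ->
  rank_ge (seminormalized A (M + M) d) a [::] \/
  rank_ge (seminormalized B (M + M) d) a [::].
Proof.
set T := seminormalized _ _ _ => d0 Ta.
pose cA x := d <= `|A x|; pose cB x := ~~ cA x.
have TA s : T s -> seminormalized A M d [seq x <- s | cA x].
  move=> /(seminormalized_subseq (filter_subseq cA s)) [s1 sM _].
  by split=> // x; rewrite mem_filter => /andP[].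
have TB s : T s -> seminormalized B M d [seq x <- s | cB x].
  move=> /(seminormalized_subseq (filter_subseq cB s)) [s1 sM sd].
  split=> // x xs; have dd := sd x xs; move: xs.
  rewrite mem_filter => /andP[+ _]; rewrite /cB /cA.
  rewrite -real_ltNge ?normr_real ?ger0_real // => /ltW Ad.
  rewrite -(lerD2l d); apply: le_trans dd _.
  by apply: (le_trans (ler_normD _ _)); rewrite lerD2r.
have sub (S : X -> Y) : rank_ge (merges (seminormalized S M d)) a [::] ->
    rank_ge (seminormalized S (M + M) d) a [::].
  by apply: rank_ge_sub; exact: merges_seminormalized.
have [AB|BA] :=
  rank_ge_total (seminormalized A M d) (seminormalized B M d) [::] [::].
  right; apply: sub; apply: (@rank_ge_merges _ T _ _ cB cA) AB _ Ta.
    by move=> x; rewrite /cB negbK.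
  by move=> s Ts; split; [apply: TB | apply: TA].
left; apply: sub; apply: (@rank_ge_merges _ T _ _ cA cB) BA _ Ta => //.
by move=> s Ts; split; [apply: TA | apply: TB].
Qed.

(** The rank of the root decides, since a tree closed under prefixes is empty
    once it has lost its root. *)
Lemma NP_infty_le (A : X -> Y) a :
  eole (NP_infty A) (Fin a) <->
  forall C, 1 <= C -> ~ rank_ge (T_infty A C) a [::].
Proof.
rewrite /NP_infty esup_lub.
have C_gt0 (C : K) : 1 <= C -> 0 < C by apply: lt_le_trans.
have derE C : 1 <= C -> derived (T_infty A C) a = set0 <->
    ~ rank_ge (T_infty A C) a [::].
  move=> /C_gt0 C0; have pc := @T_infty_prefix_closed _ _ _ A _ C0.
  rewrite -derived_rank_ge //; split=> [-> []|nD].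
  apply/seteqP; split=> // s Ds; apply: nD.
  by apply: derived_prefix_closed Ds => //; apply: prefix0s.
split=> H.
  move=> C C1; apply/derE => //; have := H (exist _ C C1) => /=.
  have := tree_orderP (T_infty A C).
  case: (tree_order _) => [b [b0 _] /= ba|_ []].
  by apply/seteqP; split=> // s /(derived_anti ba); rewrite b0.
move=> [C C1] /=; have := tree_orderP (T_infty A C).
have D0 := (derE C C1).2 (H C C1).
by case: (tree_order _) => [b [_ /(_ _ D0)]|/(_ _ D0)].
Qed.

Lemma NP_infty_add (pK : precompact_ball K) (aK : Num.archimedean_axiom K)
    (A B : {linear X -> Y}) : bounded_operator A -> bounded_operator B ->
  eole (NP_infty (A \+ B))
       (emul (Fin omega) (emax (NP_infty A) (NP_infty B))).
Proof.
move=> bA bB; set m := emax _ _.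
have [Am Bm] : eole (NP_infty A) m /\ eole (NP_infty B) m.
  rewrite /m /emax; case: asboolP => [AB|nAB]; split=> //.
  - by case: (NP_infty B) => //= a; apply: ole_refl.
  - by case: (NP_infty A) => //= a; apply: ole_refl.
  - by case: (eole_total (NP_infty A) (NP_infty B)).
case: m Am Bm => [a|_ _]; last by case: (NP_infty _).
move=> /NP_infty_le Aa /NP_infty_le Ba; apply/NP_infty_le => C C1.
have C0 : 0 < C by apply: lt_le_trans C1.
pose d := C^-1 / 2; have d0 : 0 < d by rewrite divr_gt0 ?invr_gt0.
have C8 : 1 <= 8 / d.
  rewrite /d invf_div invrK mulrA -natrM.
  by apply: mulr_ege1 => //; rewrite ler1n.
have absurd (S : {linear X -> Y}) : bounded_operator S ->
    (forall C, 1 <= C -> ~ rank_ge (T_infty S C) a [::]) ->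
    ~ rank_ge (seminormalized S (1 + 1) d) (omul omega a) [::].
  move=> bS Sa SR; apply: (Sa _ C8).
  apply: (rank_ge_T_infty pK aK bS d0 SR (sub0seq _)).
  exists (d / 2); split=> //.
  by rewrite ltr_pM2l // ltf_pV2 ?posrE // ltr_nat.
move=> /(rank_ge_sub (T_infty_seminormalized C0)).
rewrite [C^-1]splitr => /(seminormalized_add_rank (ltW d0)) [].
  exact: absurd.
exact: absurd.
Qed.

End Main.

Lemma precompact_ball_real (R : archiRealFieldType) : precompact_ball R.
Proof.
move=> e e0; pose f (x : R) := Num.truncn ((x + 1) / e).
exists 'I_(Num.truncn (2 / e)).+1, (fun x => inord (f x)) => x y x1 y1.
have f_lt z : `|z| <= 1 -> (f z < (Num.truncn (2 / e)).+1)%N.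
  rewrite ler_norml => /andP[_ z1]; rewrite ltnS; apply: le_truncn.
  by rewrite ler_pM2r ?invr_gt0 // lerD2r.
have f_itv z : `|z| <= 1 -> (f z)%:R <= (z + 1) / e < (f z).+1%:R.
  rewrite ler_norml => /andP[z1 _]; apply: truncn_itv.
  by rewrite divr_ge0 ?(ltW e0) // -lerBlDr sub0r.
move=> /(congr1 val); rewrite /= !inordK ?f_lt // => fxy.
have := f_itv _ x1; have := f_itv _ y1; rewrite fxy.
rewrite !ler_pdivlMr // !ltr_pdivrMr // -natr1 mulrDl mul1r.
move=> /andP[] ? ? /andP[] ? ?; rewrite ler_norml; apply/andP; split; lra.
Qed.

(** Real and imaginary parts are classified with diameter [e / 2], and
    [2 (e / 2)^2 <= e^2]. *)
Lemma precompact_ball_complex (R : archiRcfType) : precompact_ball R[i].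
Proof.
move=> [e e']; rewrite ltcE /= => /andP[/eqP e'0 e0]; subst e'.
have e20 : 0 < e / 2 by apply: divr_gt0.
have [F [rho rhoP]] := precompact_ball_real e20.
exists (F * F)%type, (fun z => (rho (complex.Re z), rho (complex.Im z))).
have le1 (a b : R) : Num.sqrt (a ^+ 2 + b ^+ 2) <= 1 -> `|a| <= 1.
  by apply: le_trans; rewrite -sqrtr_sqr ler_wsqrtr // lerDl sqr_ge0.
have le_sqr (a : R) : `|a| <= e / 2 -> a ^+ 2 <= (e / 2) ^+ 2.
  move=> ae; rewrite -real_normK ?num_real // ler_pXn2r ?nnegrE //.
  exact: ltW.
move=> [a b] [a' b']; rewrite !normc_def !lecR /= => ab ab' [rhoa rhob].
have /le_sqr da := rhoP _ _ (le1 _ _ ab) (le1 _ _ ab') rhoa.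
move: ab ab'; rewrite addrC [_ + b' ^+ 2]addrC => ba ba'.
have /le_sqr db := rhoP _ _ (le1 _ _ ba) (le1 _ _ ba') rhob.
rewrite -[leRHS]ger0_norm ?(ltW e0) // -sqrtr_sqr ler_wsqrtr //.
apply: le_trans (lerD da db) _.
nra.
Qed.

Lemma archimedean_complex (R : archiRcfType) : Num.archimedean_axiom R[i].
Proof.
move=> z; rewrite normc_def; set r := Num.sqrt _.
exists (Num.bound r); rewrite -(rmorph_nat (real_complex R)) ltcR.
by apply: archi_boundP; apply: sqrtr_ge0.
Qed.

Theorem lemma3p4 (R : realType) :
  (forall (X Y : completeNormedModType R) (A B : {linear X -> Y}),
      bounded_operator A -> bounded_operator B ->
      eole (NP_infty (A \+ B))
           (emul (Fin omega) (emax (NP_infty A) (NP_infty B)))) /\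
  (forall (X Y : completeNormedModType R[i]) (A B : {linear X -> Y}),
      bounded_operator A -> bounded_operator B ->
      eole (NP_infty (A \+ B))
           (emul (Fin omega) (emax (NP_infty A) (NP_infty B)))).
Proof.
split=> X Y A B; apply: NP_infty_add.
- exact: precompact_ball_real.
- by move=> x; exists (Num.bound `|x|); apply: Num.Theory.archi_boundP.
- exact: precompact_ball_complex.
- exact: archimedean_complex.
Qed.
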